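(* Let $p$ be a prime, let $\mathbb{Z}_p$ be the compact group of $p$-adic integers, let $m \geq 1$, and let $\mathbb{Z}_p$ act diagonally on the iterated topological join $\mathbb{Z}_p^{*m}$ of $m$ copies of $\mathbb{Z}_p$. Let $\tau\in\widehat{\mathbb{Z}_p}$ be a (continuous) character. Then the spectral count satisfies $c_\tau(C(\mathbb{Z}_p^{*m}))\leq 1$, regardless of the choice of $m$.
   Context: The join of compact Hausdorff spaces $X$ and $G$ is $X*G=(X\times G\times[0,1])/\sim$, where $(x,g,0)\sim(x,h,0)$ for all $x \in X$, $g,h \in G$ and $(x,g,1)\sim(y,g,1)$ for all $x,y \in X$, $g \in G$. If a compact group $G$ acts on $X$, the diagonal action on $X*G$ is $[(x,g,t)]\cdot h=[(x\cdot h,gh,t)]$. The iterated join $G^{*m}$ joins $m$ copies of $G$ (with $G^{*1}=G$), with the diagonal action. If a compact abelian group $G$ acts on a unital $C^*$-algebra $A$ by $\beta$ and $\tau\in\widehat{G}$, the $\tau$-spectral subspace is $A_\tau=\{a\in A:\beta_g(a)=\tau(g)a\ \ \forall g\in G\}$; on $A = C(X)$ the action is the one dual to the action of $G$ on $X$, $(\beta_gf)(x)=f(x\cdot g)$. The spectral count is $$c_\tau(A)=\inf\Big\{n\geq 0:\exists\, a_0,b_0,\ldots,a_n,b_n\in A_\tau \text{ such that } \sum_{i=0}^n a_ib_i^*\text{ is invertible}\Big\}.$$ *)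

(* Defs.v *)
From HB Require Import structures.
From mathcomp Require Import all_boot all_order all_algebra.
From mathcomp Require Import generic_quotient.
From mathcomp Require Import all_classical all_reals all_analysis complex.

Set Implicit Arguments.
Unset Strict Implicit.
Unset Printing Implicit Defensive.

Import Order.TTheory GRing.Theory Num.Theory numFieldNormedType.Exports.

Local Open Scope classical_set_scope.
Local Open Scope quotient_scope.
Local Open Scope ring_scope.

(* Abelian topological groups are written additively, so the product [gh] of
   two group elements is [g + h]. *)
Record compactGroup := CompactGroup {
  cgroup_sort :> topologicalZmodType;
  cgroup_compact : compact [set: cgroup_sort];
  cgroup_hausdorff : hausdorff_space cgroup_sort }.

(* [gact x g] is x . g, a right action. *)
Record gspace (G : compactGroup) := GSpace {
  gspace_sort :> topologicalType;
  gspace_compact : compact [set: gspace_sort];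
  gspace_hausdorff : hausdorff_space gspace_sort;
  gact : gspace_sort -> G -> gspace_sort;
  gact0 : forall x, gact x 0 = x;
  gactD : forall x g h, gact x (g + h) = gact (gact x g) h;
  gact_continuous : continuous (fun xg : gspace_sort * G => gact xg.1 xg.2) }.

Section RegularGSpace.
Variable G : compactGroup.

Definition regular_gact (x g : G) : G := x + g.

Let regular_gact0 x : regular_gact x 0 = x.
Proof. exact: addr0. Qed.

Let regular_gactD x g h :
  regular_gact x (g + h) = regular_gact (regular_gact x g) h.
Proof. exact: addrA. Qed.

Let regular_gact_continuous :
  continuous (fun xg : G * G => regular_gact xg.1 xg.2).
Proof. exact: add_continuous. Qed.

Definition regular_gspace : gspace G :=
  GSpace (@cgroup_compact G) (@cgroup_hausdorff G)
    regular_gact0 regular_gactD regular_gact_continuous.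

End RegularGSpace.

Lemma set_type_compact (T : topologicalType) (A : set T) :
  compact A -> compact [set: set_type A].
Proof.
move=> cA F PF _.
have /= := cA (fmap (set_val : A -> T) F) _ _.
case=> [|x [Ax clx]].
  apply: filterS (@filterT _ F _) => x _; exact: set_valP.
exists (exist _ x (mem_set Ax)); split=> // B C FB [D [[E oE <-] /= Ex EC]].
have nE : nbhs x E by apply: open_nbhs_nbhs; split.
have FB' : fmap (set_val : A -> T) F (set_val @` B).
  by apply: (@filterS _ F _ B) => // y By; exists y.
have [_ [[y By <-] Ey]] := clx _ _ FB' nE.
by exists y; split=> //; exact: EC.
Qed.

Section Join.
Variables (R : realType) (X Y : topologicalType).

Definition unit_interval : topologicalType := set_type `[0 : R, 1]%classic.

Definition prejoin : topologicalType := (X * Y * unit_interval)%type.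

(* This relation is already an equivalence, so it is the one generated by
   (x,g,0) ~ (x,h,0) and (x,g,1) ~ (y,g,1). *)
Definition join_rel (a b : prejoin) : Prop :=
  [\/ a = b,
      [/\ \val a.2 = 0, \val b.2 = 0 & a.1.1 = b.1.1] |
      [/\ \val a.2 = 1, \val b.2 = 1 & a.1.2 = b.1.2]].

Definition join_relb : rel prejoin := fun a b => `[< join_rel a b >].

Lemma join_rel_refl : reflexive join_relb.
Proof. by move=> a; apply/asboolP; apply: Or31. Qed.

Lemma join_rel_sym : symmetric join_relb.
Proof.
suff H a b : join_rel a b -> join_rel b a.
  by move=> a b; apply/asboolP/asboolP; exact: H.
by case=> [->|[? ? ?]|[? ? ?]]; [apply: Or31|apply: Or32|apply: Or33].
Qed.

Lemma join_rel_trans : transitive join_relb.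
Proof.
move=> b a c /asboolP ab /asboolP bc; apply/asboolP.
have abs (t : R) : t = 0 -> t = 1 -> False.
  by move=> -> /eqP; rewrite eq_sym oner_eq0.
case: ab => [->//|[a0 b0 e]|[a1 b1 e]].
  case: bc => [<-|[_ c0 e']|[b1 _ _]]; last by case: (abs _ b0 b1).
    by apply: Or32.
  by apply: Or32; split=> //; rewrite e.
case: bc => [<-|[b0 _ _]|[_ c1 e']]; last 2 first.
- by case: (abs _ b0 b1).
- by apply: Or33; split=> //; rewrite e.
- by apply: Or33.
Qed.

Canonical join_equiv :=
  EquivRel join_relb join_rel_refl join_rel_sym join_rel_trans.

Definition join : topologicalType :=
  quotient_topology {eq_quot join_equiv}.

Definition join_pi (a : prejoin) : join := \pi_{eq_quot join_equiv} a.

Lemma join_piP a b : join_pi a = join_pi b <-> join_rel a b.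
Proof.
rewrite -[_ = _]/(\pi_{eq_quot join_equiv} a = \pi_{eq_quot join_equiv} b).
by split=> [/eqmodP/asboolP//|ab]; apply/eqmodP/asboolP.
Qed.

Lemma join_pi_continuous : continuous join_pi.
Proof. exact: pi_continuous. Qed.

Lemma join_pi_surj z : exists a, join_pi a = z.
Proof. by exists (repr (z : {eq_quot join_equiv})); exact: reprK. Qed.

Lemma join_continuousP (Z : topologicalType) (f : join -> Z) :
  continuous (f \o join_pi) -> continuous f.
Proof. by move=> ?; apply/quotient_continuous. Qed.

End Join.

Section JoinSpace.
Variable R : realType.

Lemma prejoin_compact (X Y : topologicalType) :
  compact [set: X] -> compact [set: Y] -> compact [set: prejoin R X Y].
Proof.
move=> cX cY.
have cI : compact [set: unit_interval R].
  by apply: set_type_compact; exact: segment_compact.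
by have := compact_setX (compact_setX cX cY) cI; rewrite !setXTT.
Qed.

Lemma join_compact (X Y : topologicalType) :
  compact [set: X] -> compact [set: Y] -> compact [set: join R X Y].
Proof.
move=> /prejoin_compact + /[dup] cY => /[apply] cP.
have -> : [set: join R X Y] = @join_pi R X Y @` setT.
  by rewrite eqEsubset; split=> // z _; have [a <-] := join_pi_surj z; exists a.
by apply: continuous_compact => //; apply: continuous_subspaceT => ?;
  exact: join_pi_continuous.
Qed.

Let separate (X : topologicalType) (x y : X) :
  compact [set: X] -> hausdorff_space X -> x <> y ->
  exists2 f : X -> R, continuous f & f x = 0 /\ f y = 1.
Proof.
move=> cX hX xy.
have cl (z : X) : closed [set z].
  have := @compact_closed X [set z] hX; apply; exact: compact_set1.
have /(@normal_separatorP R)/(_ _ _ (cl x) (cl y)) nXY : normal_space X.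
  exact: compact_normal hX cX.
have xy0 : [set x] `&` [set y] = set0.
  by rewrite -subset0 => z [/= -> /xy].
have [f [cf _ f0 f1]] :=
  (@uniform_separatorP _ R [set x] [set y]).1 (nXY xy0).
exists f => //.
by split; [apply: f0; exists x|apply: f1; exists y].
Qed.

Let hausdorff_of_separated (T : topologicalType) :
  (forall x y : T, x <> y -> exists2 f : T -> R, continuous f & f x <> f y) ->
  hausdorff_space T.
Proof.
move=> sep x y xy; apply: contrapT => /sep[f cf]; apply.
apply: (@Rhausdorff R) => A B nA nB.
have [z [Az Bz]] := xy _ _ (cf _ _ nA) (cf _ _ nB).
by exists (f z).
Qed.

Lemma join_hausdorff (X Y : topologicalType) :
  compact [set: X] -> hausdorff_space X ->
  compact [set: Y] -> hausdorff_space Y -> hausdorff_space (join R X Y).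
Proof.
move=> cX hX cY hY; apply: hausdorff_of_separated => z w.
have [a <-] := join_pi_surj z; have [b <-] := join_pi_surj w.
move=> nab.
have descend (f : prejoin R X Y -> R) : continuous f ->
    (forall a b, join_rel a b -> f a = f b) -> f a <> f b ->
    exists2 f : join R X Y -> R, continuous f &
      f (join_pi a) <> f (join_pi b).
  move=> cf rf fab.
  pose g z := f (projT1 (cid (join_pi_surj (z : join R X Y)))).
  have gE c : g (join_pi c) = f c.
    by rewrite /g; case: cid => d /= /join_piP/rf.
  exists g; last by rewrite !gE.
  by apply: join_continuousP; rewrite (_ : _ \o _ = f)//; apply/funext.
have cval : continuous (fun a : prejoin R X Y => \val a.2 : R).
  move=> c; apply: (@continuous_comp _ _ _ snd); first exact: cvg_snd.
  exact: initial_continuous.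
have cx : continuous (fun a : prejoin R X Y => a.1.1).
  by move=> c; apply: (@continuous_comp _ _ _ fst); exact: cvg_fst.
have cy : continuous (fun a : prejoin R X Y => a.1.2).
  move=> c; apply: (@continuous_comp _ _ _ fst); [exact: cvg_fst|].
  exact: cvg_snd.
have [tab|tab] := eqVneq (\val a.2 : R) (\val b.2); last first.
  apply: (descend (fun a => \val a.2)) => //; last exact/eqP.
  by move=> c d [->//|[-> -> _]//|[-> -> _]].
have nr : ~ join_rel a b by move=> /join_piP.
have [[t1 xab]|/not_andP nx] :=
    pselect ((\val a.2 : R) <> 1 /\ a.1.1 <> b.1.1).
  have [f cf [f0 f1]] := separate cX hX xab.
  apply: (descend (fun a => (1 - \val a.2) * f a.1.1)).
  - move=> c; apply: cvgM; first by apply: cvgB; [exact: cvg_cst|exact: cval].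
    exact: (@continuous_comp _ _ _ (fun a : prejoin R X Y => a.1.1) f _
            (cx c) (cf _)).
  - by move=> c d [->//|[-> -> ->]//|[-> -> _]]; rewrite subrr !mul0r.
  - rewrite f0 f1 mulr0 mulr1 -tab => /esym/eqP.
    by rewrite subr_eq0 => /eqP/esym.
have [[t0 yab]|/not_andP ny] :=
    pselect ((\val a.2 : R) <> 0 /\ a.1.2 <> b.1.2).
  have [f cf [f0 f1]] := separate cY hY yab.
  apply: (descend (fun a => \val a.2 * f a.1.2)).
  - move=> c; apply: cvgM; first exact: cval.
    exact: (@continuous_comp _ _ _ (fun a : prejoin R X Y => a.1.2) f _
            (cy c) (cf _)).
  - by move=> c d [->//|[-> -> _]|[-> -> ->]//]; rewrite !mul0r.
  - by rewrite f0 f1 mulr0 mulr1 -tab => /esym.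
exfalso; apply: nr.
case: nx => /contrapT ex; case: ny => /contrapT ey.
- by move: ey; rewrite ex => /eqP; rewrite oner_eq0.
- by apply: Or33; rewrite -tab.
- by apply: Or32; rewrite -tab.
- apply: Or31; case: a b tab ex ey {nab descend} => [[x y] t] [[x' y'] t'] /=.
  by move=> /val_inj -> -> ->.
Qed.

End JoinSpace.

Section JoinGSpace.
Variables (R : realType) (G : compactGroup) (X : gspace G).
Local Notation P := (prejoin R X G).
Local Notation J := (join R X G).

Let continuous_pair (S T U : topologicalType) (f : S -> T) (g : S -> U) x :
  {for x, continuous f} -> {for x, continuous g} ->
  {for x, continuous (fun y => (f y, g y))}.
Proof. by move=> cf cg; exact: (cvg_pair cf cg). Qed.

Definition prejoin_act (a : P) (h : G) : P :=
  ((gact a.1.1 h, a.1.2 + h), a.2).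

Definition join_act (z : J) (h : G) : J :=
  join_pi (prejoin_act (repr (z : {eq_quot join_equiv R X G})) h).

Lemma join_actE a h : join_act (join_pi a) h = join_pi (prejoin_act a h).
Proof.
apply/join_piP; rewrite /join_act.
set b := repr _; have : join_rel b a by apply/join_piP; exact: reprK.
case=> [->|[b0 a0 e]|[b1 a1 e]]; first exact: Or31.
  by apply: Or32; rewrite /prejoin_act /= e.
by apply: Or33; rewrite /prejoin_act /= e.
Qed.

Let join_act0 z : join_act z 0 = z.
Proof.
have [[[x g] t] <-] := join_pi_surj z.
by rewrite join_actE /prejoin_act /= gact0 addr0.
Qed.

Let join_actD z g h : join_act z (g + h) = join_act (join_act z g) h.
Proof.
have [[[x k] t] <-] := join_pi_surj z.
by rewrite !join_actE /prejoin_act /= gactD addrA.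
Qed.

Let join_space_compact : compact [set: J].
Proof. exact: join_compact (@gspace_compact _ X) (@cgroup_compact G). Qed.

Let join_space_hausdorff : hausdorff_space J.
Proof.
exact: join_hausdorff (@gspace_compact _ X) (@gspace_hausdorff _ X)
  (@cgroup_compact G) (@cgroup_hausdorff G).
Qed.

Let join_act_continuous : continuous (fun zh : J * G => join_act zh.1 zh.2).
Proof.
pose pact (ah : P * G) : J := join_pi (prejoin_act ah.1 ah.2).
have c1 : continuous (fun ah : P * G => ah.1) by move=> ah; exact: cvg_fst.
have c2 : continuous (fun ah : P * G => ah.2) by move=> ah; exact: cvg_snd.
have c11 : continuous (fun ah : P * G => ah.1.1).
  by move=> ah; apply: (continuous_comp (c1 ah)); exact: cvg_fst.
have c12 : continuous (fun ah : P * G => ah.1.2).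
  by move=> ah; apply: (continuous_comp (c1 ah)); exact: cvg_snd.
have c111 : continuous (fun ah : P * G => ah.1.1.1).
  by move=> ah; apply: (continuous_comp (c11 ah)); exact: cvg_fst.
have c112 : continuous (fun ah : P * G => ah.1.1.2).
  by move=> ah; apply: (continuous_comp (c11 ah)); exact: cvg_snd.
have cpact : continuous pact.
  move=> ah; apply: (@continuous_comp _ _ _
    (fun ah : P * G => prejoin_act ah.1 ah.2)); last exact: join_pi_continuous.
  apply: (continuous_pair _ (c12 ah)); apply: continuous_pair.
    exact: (continuous_comp (continuous_pair (c111 ah) (c2 ah))
      (@gact_continuous _ X _)).
  exact: (continuous_comp (continuous_pair (c112 ah) (c2 ah))
    (@add_continuous G _)).
pose q (ah : P * G) : J * G := (join_pi ah.1, ah.2).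
have cq : continuous q.
  move=> ah; apply: (continuous_pair _ (c2 ah)).
  exact: (continuous_comp (c1 ah) (@join_pi_continuous _ _ _ _)).
have cPG : compact [set: P * G].
  rewrite -setXTT; apply: compact_setX; last exact: cgroup_compact.
  exact: prejoin_compact (@gspace_compact _ X) (@cgroup_compact G).
have hJG : hausdorff_space (J * G)%type.
  move=> [z h] [w k] cl; congr (_, _).
    apply: join_space_hausdorff => A B nA nB.
    have [[u v] [/= Au Bu]] := cl (fst @^-1` A) (fst @^-1` B)
      (cvg_fst nA) (cvg_fst nB).
    by exists u.
  apply: (@cgroup_hausdorff G) => A B nA nB.
  have [[u v] [/= Av Bv]] := cl (snd @^-1` A) (snd @^-1` B)
    (cvg_snd nA) (cvg_snd nB).
  by exists v.
apply/continuous_closedP => C cC.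
have -> : (fun zh : J * G => join_act zh.1 zh.2) @^-1` C = q @` (pact @^-1` C).
  rewrite eqEsubset; split=> [[z h] /= Czh|_ [[a h] Cah <-]] /=.
    have [a az] := join_pi_surj z.
    by exists (a, h); rewrite /q /pact /= -?join_actE ?az.
  by rewrite join_actE.
apply: compact_closed hJG _; apply: continuous_compact.
  by apply: continuous_subspaceT => ?; exact: cq.
apply: subclosed_compact cPG _ => //.
by apply: preimage_closed => // ? _; exact: cpact.
Qed.

Definition join_gspace : gspace G :=
  GSpace join_space_compact join_space_hausdorff join_act0 join_actD
    join_act_continuous.

End JoinGSpace.

Section PadicIntegers.
Variable p : nat.

(* The inverse limit of the Z/p^n: the n-th coordinate is the representative in
   [0, p^n) of the residue modulo p^n. *)
Definition padic_set : set {ptws nat -> discrete_topology int} :=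
  [set x | forall n, x n = (x n.+1 %% p%:Z ^+ n)%Z].

Definition padic_int : Type := set_type padic_set.

HB.instance Definition _ := Topological.on padic_int.

Definition residue (x : padic_int) (n : nat) : int := set_val x n.

Lemma residueE (x : padic_int) n :
  residue x n = (residue x n.+1 %% p%:Z ^+ n)%Z.
Proof. exact: (set_valP x). Qed.

Lemma residue_mod (x : padic_int) n :
  (residue x n %% p%:Z ^+ n)%Z = residue x n.
Proof. by rewrite residueE modz_mod. Qed.

Lemma residue_inj (x y : padic_int) : residue x =1 residue y -> x = y.
Proof. by move=> xy; apply: val_inj; apply/funext. Qed.

Lemma residue_subproof (f : nat -> int) :
  (forall n, (f n.+1 %% p%:Z ^+ n)%Z = (f n %% p%:Z ^+ n)%Z) ->
  (fun n => (f n %% p%:Z ^+ n)%Z) \in padic_set.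
Proof.
move=> fE; apply/mem_set => n /=; rewrite -fE [p%:Z ^+ n.+1]exprSr.
have {1}-> := divz_eq (f n.+1) (p%:Z ^+ n * p%:Z).
by rewrite [p%:Z ^+ n * _]mulrC mulrA modzMDl.
Qed.

Definition mkpadic f fE : padic_int :=
  exist (fun x => x \in padic_set) _ (@residue_subproof f fE).

Lemma residue_mkpadic f fE n :
  residue (@mkpadic f fE) n = (f n %% p%:Z ^+ n)%Z.
Proof. by []. Qed.

Lemma residue_modS (x : padic_int) n :
  (residue x n.+1 %% p%:Z ^+ n)%Z = (residue x n %% p%:Z ^+ n)%Z.
Proof. by rewrite residue_mod -residueE. Qed.

Let padic_add_subproof (x y : padic_int) n :
  ((residue x n.+1 + residue y n.+1) %% p%:Z ^+ n)%Z =
  ((residue x n + residue y n) %% p%:Z ^+ n)%Z.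
Proof. by rewrite -modzDm !residue_modS modzDm. Qed.

Let padic_opp_subproof (x : padic_int) n :
  ((- residue x n.+1) %% p%:Z ^+ n)%Z = ((- residue x n) %% p%:Z ^+ n)%Z.
Proof. by rewrite -modzNm residue_modS modzNm. Qed.

Let padic_zero_subproof n : (0 %% p%:Z ^+ n)%Z = (0 %% p%:Z ^+ n)%Z.
Proof. by []. Qed.

Definition padic_add (x y : padic_int) : padic_int :=
  mkpadic (padic_add_subproof x y).
Definition padic_opp (x : padic_int) : padic_int :=
  mkpadic (padic_opp_subproof x).
Definition padic_zero : padic_int := @mkpadic (fun=> 0) padic_zero_subproof.

Let padic_addA : associative padic_add.
Proof.
move=> x y z; apply: residue_inj => n.
by rewrite !residue_mkpadic modzDmr modzDml addrA.
Qed.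

Let padic_addC : commutative padic_add.
Proof. by move=> x y; apply: residue_inj => n;
  rewrite !residue_mkpadic addrC. Qed.

Let padic_add0 : left_id padic_zero padic_add.
Proof.
move=> x; apply: residue_inj => n; rewrite !residue_mkpadic mod0z add0r.
exact: residue_mod.
Qed.

Let padic_addN : left_inverse padic_zero padic_opp padic_add.
Proof.
by move=> x; apply: residue_inj => n; rewrite !residue_mkpadic modzDml addNr.
Qed.

HB.instance Definition _ :=
  GRing.isZmodule.Build padic_int padic_addA padic_addC padic_add0 padic_addN.

Lemma residueD (x y : padic_int) n :
  residue (x + y) n = ((residue x n + residue y n) %% p%:Z ^+ n)%Z.
Proof. by []. Qed.

Lemma residueN (x : padic_int) n :
  residue (- x) n = ((- residue x n) %% p%:Z ^+ n)%Z.
Proof. by []. Qed.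

Lemma residue_continuous n :
  continuous (fun x : padic_int => residue x n : discrete_topology int).
Proof.
move=> x; apply: (@continuous_comp padic_int
  {ptws nat -> discrete_topology int} _ set_val (fun f => f n)).
  exact: initial_continuous.
exact: (@proj_continuous nat (fun=> discrete_topology int)).
Qed.

Lemma padic_continuous (T : topologicalType) (f : T -> padic_int) :
  (forall n, continuous (fun t => residue (f t) n : discrete_topology int)) ->
  continuous f.
Proof.
move=> cf; apply: continuous_comp_initial => t.
by apply/(@pointwise_cvgP nat (discrete_topology int)) => n; exact: cf.
Qed.

Let discrete_cvgP (T : topologicalType) (f : T -> discrete_topology int) t :
  {for t, continuous f} <-> \forall u \near t, f u = f t.
Proof.
split=> [/(_ [set f t])|ft]; first by apply; exact: discrete_set1.
apply/discrete_cvg; exact: ft.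
Qed.

Let padic_add_continuous :
  continuous (fun xy : padic_int * padic_int => xy.1 + xy.2).
Proof.
apply: padic_continuous => n [x y]; apply/discrete_cvgP.
have /discrete_cvgP nx := @residue_continuous n x.
have /discrete_cvgP ny := @residue_continuous n y.
exists ([set u | residue u n = residue x n],
        [set u | residue u n = residue y n]) => // -[u v] [/= ux vy].
by rewrite !residueD ux vy.
Qed.

Let padic_opp_continuous : continuous (-%R : padic_int -> padic_int).
Proof.
apply: padic_continuous => n x; apply/discrete_cvgP.
have /discrete_cvgP := @residue_continuous n x.
by apply: filterS => u ux; rewrite !residueN ux.
Qed.

HB.instance Definition _ :=
  PreTopologicalNmodule_isTopologicalNmodule.Build padic_int
    padic_add_continuous.
HB.instance Definition _ :=
  TopologicalNmodule_isTopologicalZmodule.Build padic_int padic_opp_continuous.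

Lemma padic_hausdorff : hausdorff_space padic_int.
Proof.
move=> x y xy; apply: residue_inj => n.
have /discrete_cvgP nx := @residue_continuous n x.
have /discrete_cvgP ny := @residue_continuous n y.
by have [z [<- <-]] := xy _ _ nx ny.
Qed.

Lemma padic_compact : (0 < p)%N -> compact [set: padic_int].
Proof.
move=> p0; apply: set_type_compact.
pose A n : set (discrete_topology int) := [set z | 0 <= z < p%:Z ^+ n].
have cA n : compact (A n).
  apply: finite_compact.
  apply: (@sub_finite_set _ _ [set k%:Z | k in `I_(p ^ n)%N]).
    move=> z /= /andP[]; case: z => // k _.
    rewrite -[p%:Z]natz -natrX natz ltz_nat => kp.
    by exists k.
  exact/finite_image/finite_II.
have cprod : compact ([set f | forall n, A n (f n)] :
    set {ptws nat -> discrete_topology int}).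
  exact: (@tychonoff nat (fun=> discrete_topology int) A cA).
apply: (subclosed_compact _ cprod).
  rewrite (_ : padic_set = \bigcap_n [set x | x n = (x n.+1 %% p%:Z ^+ n)%Z]);
    last by apply/seteqP; split=> x xP n; [move=> _|]; exact: xP.
  apply: closed_bigI => n _; rewrite -openC.
  rewrite openE => x /= nx.
  have c k := @proj_continuous nat (fun=> discrete_topology int) k x.
  have /discrete_cvgP n0 := c n; have /discrete_cvgP n1 := c n.+1.
  by apply: filterS2 n0 n1 => y; rewrite /proj /= => -> ->.
move=> x xP n /=; rewrite xP /A /= modz_ge0 ?ltz_pmod //.
  by rewrite exprn_gt0.
by rewrite expf_neq0 // gt_eqF.
Qed.

End PadicIntegers.

Definition padic_group (p : nat) (p_prime : prime p) : compactGroup :=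
  CompactGroup (padic_compact (prime_gt0 p_prime)) (@padic_hausdorff p).

(* Unital complex *-algebras; the spectral count does not involve the norm of a
   C*-algebra. The library's algType is not used because it excludes the zero
   algebra, hence C(X) for X empty. *)
HB.mixin Record PzRing_isStarAlgebra (R : rcfType) A of GRing.PzRing A := {
  cscale : R[i] -> A -> A;
  cscaleA : forall c d a, cscale c (cscale d a) = cscale (c * d) a;
  cscale1 : left_id 1 cscale;
  cscaleDr : right_distributive cscale +%R;
  cscaleDl : forall a, {morph cscale^~ a : c d / c + d};
  cscaleAl : forall c a b, cscale c (a * b) = cscale c a * b;
  cscaleAr : forall c a b, cscale c (a * b) = a * cscale c b;
  star : A -> A;
  starK : involutive star;
  starD : {morph star : a b / a + b};
  starM : forall a b, star (a * b) = star b * star a;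
  star_cscale : forall c a, star (cscale c a) = cscale c^* (star a) }.

#[short(type="starAlgType")]
HB.structure Definition StarAlgebra (R : rcfType) :=
  { A of GRing.PzRing A & PzRing_isStarAlgebra R A }.

(* Continuous homomorphisms into the unit circle; R[i]^o is R[i] with the
   topology of its norm. *)
Record character (R : realType) (G : topologicalZmodType) := Character {
  character_fun :> G -> R[i]^o;
  character_continuous : continuous character_fun;
  character_norm : forall g, `|character_fun g| = 1;
  characterD : forall g h,
    character_fun (g + h) = character_fun g * character_fun h }.

Section SpectralCount.
Variables (R : realType) (G : topologicalZmodType) (A : starAlgType R).
Variables (beta : G -> A -> A) (tau : character R G).

Definition spectral_subspace : set A :=
  [set a | forall g, beta g a = cscale (tau g) a].

Definition invertible (a : A) : Prop := exists b, a * b = 1 /\ b * a = 1.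

Definition spectral_witness (n : nat) : Prop :=
  exists a b : 'I_n.+1 -> A,
    [/\ forall i, spectral_subspace (a i),
        forall i, spectral_subspace (b i) &
        invertible (\sum_(i < n.+1) a i * star (b i))].

(* The infimum is taken in the extended reals, so it is +oo when no n works. *)
Definition spectral_count : \bar R :=
  ereal_inf [set n%:R%:E | n in [set n | spectral_witness n]].

End SpectralCount.

Definition cfun (R : realType) (X : topologicalType) : Type :=
  continuousType X R[i]^o.

Section ContinuousFunctions.
Variables (R : realType) (X : topologicalType).
Local Notation C := R[i]^o.
Local Notation CX := (cfun R X).

HB.instance Definition _ := Choice.on CX.

Definition cfun_fun (f : CX) : X -> C := Continuous.sort f.
Local Coercion cfun_fun : cfun >-> Funclass.

Definition mkcfun (f : X -> C) (cf : continuous f) : CX :=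
  [the continuousType X C of mkcts cf].

Lemma mkcfunE (f : X -> C) (cf : continuous f) x : mkcfun cf x = f x.
Proof. by []. Qed.

Lemma cfun_continuous (f : CX) : continuous f.
Proof. exact: cts_fun. Qed.

Lemma cfunP (f g : CX) : f =1 g -> f = g.
Proof. by move=> fg; apply/continuousEP. Qed.

Let cst_ct (c : C) : continuous (fun _ : X => c).
Proof. by move=> x; exact: cvg_cst. Qed.
Let add_ct (f g : CX) : continuous (fun x => f x + g x).
Proof. by move=> x; apply: cvgD; exact: cfun_continuous. Qed.
Let opp_ct (f : CX) : continuous (fun x => - f x).
Proof. by move=> x; apply: cvgN; exact: cfun_continuous. Qed.
Let mul_ct (f g : CX) : continuous (fun x => f x * g x).
Proof. by move=> x; apply: cvgM; exact: cfun_continuous. Qed.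
Let scale_ct (c : R[i]) (f : CX) : continuous (fun x => (c : C) * f x).
Proof. by move=> x; apply: cvgM; [exact: cvg_cst|exact: cfun_continuous]. Qed.
Let conj_ct (f : CX) : continuous (fun x => (f x : R[i])^* : C).
Proof.
move=> x; apply/(@cvgrPdist_lt R[i] R[i]^o) => e e0.
have /(@cvgrPdist_lt R[i] R[i]^o)/(_ e e0) := @cfun_continuous f x.
by apply: filterS => t; rewrite -norm_conjC rmorphB.
Qed.

Definition cfun_add (f g : CX) := mkcfun (@add_ct f g).
Definition cfun_opp (f : CX) := mkcfun (@opp_ct f).
Definition cfun_mul (f g : CX) := mkcfun (@mul_ct f g).
Definition cfun_scale (c : R[i]) (f : CX) := mkcfun (@scale_ct c f).
Definition cfun_star (f : CX) := mkcfun (@conj_ct f).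

Let addA : associative cfun_add.
Proof. by move=> f g h; apply: cfunP => x; exact: addrA. Qed.
Let addC : commutative cfun_add.
Proof. by move=> f g; apply: cfunP => x; exact: addrC. Qed.
Let add0 : left_id (mkcfun (@cst_ct 0)) cfun_add.
Proof. by move=> f; apply: cfunP => x; exact: add0r. Qed.
Let addN : left_inverse (mkcfun (@cst_ct 0)) cfun_opp cfun_add.
Proof. by move=> f; apply: cfunP => x; exact: addNr. Qed.

HB.instance Definition _ := GRing.isZmodule.Build CX addA addC add0 addN.

Let mulA : associative cfun_mul.
Proof. by move=> f g h; apply: cfunP => x; exact: mulrA. Qed.
Let mulf1 : left_id (mkcfun (@cst_ct 1)) cfun_mul.
Proof. by move=> f; apply: cfunP => x; exact: mul1r. Qed.
Let mulf1r : right_id (mkcfun (@cst_ct 1)) cfun_mul.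
Proof. by move=> f; apply: cfunP => x; exact: mulr1. Qed.
Let mulDl : left_distributive cfun_mul +%R.
Proof. by move=> f g h; apply: cfunP => x; exact: mulrDl. Qed.
Let mulDr : right_distributive cfun_mul +%R.
Proof. by move=> f g h; apply: cfunP => x; exact: mulrDr. Qed.

HB.instance Definition _ :=
  GRing.Zmodule_isPzRing.Build CX mulA mulf1 mulf1r mulDl mulDr.

Let scaleA c d (f : CX) :
  cfun_scale c (cfun_scale d f) = cfun_scale (c * d) f.
Proof. by apply: cfunP => x; exact: mulrA. Qed.
Let scale1 : left_id 1 cfun_scale.
Proof. by move=> f; apply: cfunP => x; exact: mul1r. Qed.
Let scaleDr : right_distributive cfun_scale +%R.
Proof. by move=> c f g; apply: cfunP => x; exact: mulrDr. Qed.
Let scaleDl (f : CX) : {morph cfun_scale^~ f : c d / c + d}.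
Proof. by move=> c d; apply: cfunP => x; exact: mulrDl. Qed.

Let cstarK : involutive cfun_star.
Proof. by move=> f; apply: cfunP => x; exact: conjCK. Qed.
Let cstarD : {morph cfun_star : f g / f + g}.
Proof. by move=> f g; apply: cfunP => x; exact: rmorphD. Qed.
Let cstarM (f g : CX) : cfun_star (f * g) = cfun_star g * cfun_star f.
Proof. by apply: cfunP => x; rewrite [RHS]mulrC; exact: rmorphM. Qed.
Let cstarZ (c : R[i]) (f : CX) :
  cfun_star (cfun_scale c f) = cfun_scale c^* (cfun_star f).
Proof. by apply: cfunP => x; exact: rmorphM. Qed.
Let cscaleAl (c : R[i]) (f g : CX) : cfun_scale c (f * g) = cfun_scale c f * g.
Proof. by apply: cfunP => x; exact: mulrA. Qed.
Let cscaleAr (c : R[i]) (f g : CX) : cfun_scale c (f * g) = f * cfun_scale c g.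
Proof. by apply: cfunP => x; exact: mulrCA. Qed.

HB.instance Definition _ := PzRing_isStarAlgebra.Build R CX
  scaleA scale1 scaleDr scaleDl cscaleAl cscaleAr cstarK cstarD cstarM cstarZ.

End ContinuousFunctions.

Coercion cfun_fun : cfun >-> Funclass.

Section DualAction.
Variables (R : realType) (G : compactGroup) (X : gspace G).

Let translate_continuous (g : G) : continuous (fun x : X => gact x g).
Proof.
move=> x; apply: (@continuous_comp _ _ _ (fun x : X => (x, g))
  (fun xg => gact xg.1 xg.2)); last exact: gact_continuous.
exact: (cvg_pair cvg_id (cvg_cst g)).
Qed.

Let dual_continuous (g : G) (f : cfun R X) :
  continuous (fun x => f (gact x g)).
Proof.
move=> x; apply: (continuous_comp (@translate_continuous g x)).
exact: cfun_continuous.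
Qed.

Definition dual_action (g : G) (f : cfun R X) : cfun R X :=
  mkcfun (@dual_continuous g f).

Lemma dual_actionE g (f : cfun R X) x : dual_action g f x = f (gact x g).
Proof. by []. Qed.

End DualAction.

(* G^{*1} = G and G^{*(m+1)} = G^{*m} * G; the value at m = 0 is junk. *)
Definition join_power (R : realType) (G : compactGroup) (m : nat) : gspace G :=
  iter m.-1 (fun X => join_gspace R X) (regular_gspace G).

(* Main.v *)
Require Import Defs.
From mathcomp Require Import all_boot all_order all_algebra.
From mathcomp Require Import all_classical all_reals all_analysis.
From mathcomp Require Import complex ring lra.

Set Implicit Arguments.
Unset Strict Implicit.
Unset Printing Implicit Defensive.

Import Order.TTheory GRing.Theory Num.Theory numFieldNormedType.Exports.

Local Open Scope ring_scope.
Local Open Scope classical_set_scope.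
Local Open Scope complex_scope.

(** Write [mu_n] for the complex [n]-th roots of unity.  For a character [chi]
    of [G], a polar pair of order [n] on a [G]-space [X] consists of two
    continuous [chi]-equivariant functions [w] and [b] without common zero such
    that [b ^ n >= 0].  The condition on [b] says that its values lie in the
    cone over [mu_n], so a polar pair is an equivariant map from [X] to the
    two-dimensional complex [S^1 * mu_n], a union of [n] discs glued along their
    boundary: [w] is the coordinate along the discs, [b / |b|] labels the disc
    and [|b|] vanishes on the common boundary.  Since [|w|^2 + |b|^2] vanishes
    nowhere, a polar pair for [tau] gives [c_tau <= 1]
    ([spectral_witness1]).  It remains to find polar pairs on all the iterated
    joins, whatever their dimension.

    On [G] itself, [(0, tau)] is a polar pair.  For the passage from [X] to
    [X * G], a [tau]-equivariant map out of [X * G] is the same as a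
    [tau]-equivariant map out of [X] together with a contraction of it through
    maps that need not be equivariant.  So take a character [chi] with
    [chi ^ q = tau] and [chi ^ (q * q) = 1] and a polar pair [(w, b)] of order
    [q * q] for [chi] on [X], and put [z = b / |b|].  Then
    [(w ^ q - z ^ q |b|, z ^ (q - 1) w |b|)]
    is [tau]-equivariant without zeros.  Where its first entry vanishes, [w] is
    a positive multiple of a [q]-th root of unity times [z], so the second entry
    lies in the cone over [mu_q].  In other words each of the [q * q] discs of
    [S^1 * mu_(q * q)] is sent to [S^1 * mu_q] by a map that has degree [q] on the
    boundary and meets each of the [q] centres exactly once.  Such a map does
    not depend, up to homotopy, on the disc: in
    [(w ^ q - u ^ q |b|, z ^ q u^-1 w |b|)]
    let [u] run along the circle from [z] to [z ^ q].  The zeros stay in the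
    same cone, and at the end, since [z ^ (q * q) = 1], the label [z] has
    disappeared; a single disc is left, which is shrunk to its centre.  This is
    the required contraction ([join_snd_gt0], [join_polar_pair]).  The phase of
    the second entry is in [mu_q] only on the zeros of the first one, which is
    repaired by an equivariant rounding ([root_phase]).

    Finally the step can be repeated forever, because every character of [Z_p]
    has [p]-power order and has a [p ^ k]-th root for every [k]
    ([character_torsion], [character_root]).  The order needed on [X] is the
    square of the one obtained on [X * G], so the induction on the number of
    factors is over all characters and orders at once. *)

Local Notation Re := complex.Re.
Local Notation Im := complex.Im.

(** * Limits of scalar functions *)
Section NumFieldLimits.
Variables (K : numFieldType) (T : Type) (F : set_system T).
Context {FF : Filter F}.

Lemma cvg_mul_bounded0 (f g : T -> K) :
  f @ F --> (0 : K) -> (forall x, `|g x| <= 1) ->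
  (fun x => f x * g x) @ F --> (0 : K).
Proof.
move=> /cvgr0Pnorm_lt f0 g1; apply/cvgr0Pnorm_lt => e e0.
have := f0 e e0; apply: filterS => x; apply: le_lt_trans.
by rewrite normrM ler_piMr.
Qed.

Lemma cvg_exprn (n : nat) (f : T -> K) (l : K) :
  f @ F --> l -> (fun x => f x ^+ n) @ F --> l ^+ n.
Proof.
move=> fl; elim: n => [|k IHk]; first exact: cvg_cst.
rewrite exprS (_ : (fun x => f x ^+ k.+1) = (fun x => f x * f x ^+ k)).
  exact: cvgM.
by apply/funext => x; rewrite exprS.
Qed.

(** Over a field of characteristic zero the [n]-th roots of [l ^ n] are isolated:
    [z ^ n - l ^ n] is [z - l] times a factor whose value at [l] is
    [n * l ^ (n - 1)].  Hence a function that takes such values and converges to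
    [l] is eventually equal to [l]; all the local constancy of phases comes from
    this. *)
Lemma near_root_eq (n : nat) (f : T -> K) (l : K) :
  (0 < n)%N -> l != 0 -> f @ F --> l -> (\forall x \near F, f x ^+ n = l ^+ n) ->
  \forall x \near F, f x = l.
Proof.
move=> n0 l0 fl fn.
(* The cofactor of [z - l] in [z ^ n - l ^ n]. *)
pose S (z : K) : K := \sum_(i < n) z ^+ (n.-1 - i) * l ^+ i.
have SF : (fun x => S (f x)) @ F --> S l.
  rewrite /S; elim: (index_enum _) => [|i r IHr].
    rewrite big_nil (_ : (fun x => _) = cst 0); first exact: cvg_cst.
    by apply/funext => x; rewrite big_nil.
  rewrite big_cons (_ : (fun x => _) = (fun x => f x ^+ (n.-1 - i) * l ^+ i +
      \sum_(j <- r) f x ^+ (n.-1 - j) * l ^+ j)).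
    by apply: cvgD => //; apply: cvgM; [exact: cvg_exprn|exact: cvg_cst].
  by apply/funext => x; rewrite big_cons.
have Sl : 0 < `|S l|.
  rewrite normr_gt0 /S (eq_bigr (fun=> l ^+ n.-1)) => [|i _].
    by rewrite sumr_const card_ord -mulr_natr mulf_neq0 ?expf_neq0 // pnatr_eq0 -lt0n.
  by rewrite -exprD subnK // -ltnS prednK.
have nS := @cvgr_norm_gt K K T F FF _ _ SF _ Sl.
apply: filterS2 fn nS => x fxn Sx.
apply/eqP; rewrite -subr_eq0.
have : (f x - l) * S (f x) == 0 by rewrite -subrXX fxn subrr.
by rewrite mulf_eq0 => /orP[//|/eqP S0]; move: Sx; rewrite S0 normr0 ltxx.
Qed.

End NumFieldLimits.

(** The topology is that of the normed space [K^o], but [f] and [l] live in [K]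
    itself, so that the ring operations in limits are those of the field. *)
Definition ctends (K : numFieldType) (T : Type) (F : set_system T)
    (f : T -> K) (l : K) : Prop :=
  (f : T -> K^o) @ F --> (l : K^o).

Section ScalarLimits.
Variables (K : numFieldType) (T : Type) (F : set_system T).
Context {FF : Filter F}.
Implicit Types (f g : T -> K) (a b : K).

Lemma ctends_cst a : ctends F (fun=> a) a.
Proof. exact: cvg_cst. Qed.

Lemma ctendsD f g a b : ctends F f a -> ctends F g b ->
  ctends F (fun x => f x + g x) (a + b).
Proof. exact: (@cvgD K K^o). Qed.

Lemma ctendsN f a : ctends F f a -> ctends F (fun x => - f x) (- a).
Proof. exact: (@cvgN K K^o). Qed.

Lemma ctendsB f g a b : ctends F f a -> ctends F g b ->
  ctends F (fun x => f x - g x) (a - b).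
Proof. by move=> fa gb; apply: ctendsD => //; exact: ctendsN. Qed.

Lemma ctendsM f g a b : ctends F f a -> ctends F g b ->
  ctends F (fun x => f x * g x) (a * b).
Proof. exact: (@cvgM K). Qed.

Lemma ctendsX n f a : ctends F f a -> ctends F (fun x => f x ^+ n) (a ^+ n).
Proof. exact: (@cvg_exprn K). Qed.

Lemma ctendsV f a : a != 0 -> ctends F f a -> ctends F (fun x => (f x)^-1) a^-1.
Proof. exact: (@cvgV K). Qed.

Lemma ctends_norm f a : ctends F f a -> ctends F (fun x => `|f x|) `|a|.
Proof. exact: (@cvg_norm K K^o). Qed.

Lemma ctends_mul_bounded0 f g :
  ctends F f 0 -> (forall x, `|g x| <= 1) -> ctends F (fun x => f x * g x) 0.
Proof. exact: (@cvg_mul_bounded0 K). Qed.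

Lemma ctends_root_eq n f a :
  (0 < n)%N -> a != 0 -> ctends F f a -> (\forall x \near F, f x ^+ n = a ^+ n) ->
  \forall x \near F, f x = a.
Proof. exact: (@near_root_eq K). Qed.

Lemma ctends_near_eq f g a :
  (\forall x \near F, f x = g x) -> ctends F g a -> ctends F f a.
Proof.
move=> fg; apply: cvg_trans; apply: near_eq_cvg.
by apply: filterS fg => x ->.
Qed.

Lemma ctends_eq f g a : f =1 g -> ctends F g a -> ctends F f a.
Proof. by move=> /funext ->. Qed.

End ScalarLimits.

Section ComplexLimits.
Variables (R : realType) (T : Type) (F : set_system T).
Context {FF : Filter F}.
Implicit Types (f g : T -> R[i]) (a b : R[i]).

Lemma ctends_real (f : T -> R) (l : R) :
  f @ F --> l -> ctends F (fun x => (f x)%:C) l%:C.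
Proof.
move=> fl; apply/(@cvgrPdist_lt R[i] R[i]^o) => e e0.
have [Re0 eE] : 0 < Re e /\ e = (Re e)%:C.
  by move: e0; case: e => a b; rewrite ltcE /= => /andP[/eqP -> ->].
have /(@cvgrPdist_lt R R^o)/(_ _ Re0) := fl.
apply: filterS => y; rewrite -rmorphB /= => h.
by rewrite normc_def /= expr0n /= addr0 sqrtr_sqr eE ltcR.
Qed.

Lemma cvg_Re f a : ctends F f a -> (fun x => Re (f x)) @ F --> Re a.
Proof.
move=> fl; apply/(@cvgrPdist_lt R R^o) => e e0.
have e0' : 0 < e%:C by rewrite ltcR.
have /(@cvgrPdist_lt R[i] R[i]^o)/(_ _ e0') := fl.
apply: filterS => y /= h.
rewrite -ltcR; apply: le_lt_trans h.
have -> : Re a - Re (f y) = Re (a - f y) by case: (a) => ? ?; case: (f y) => ? ?.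
exact: normc_ge_Re.
Qed.

Lemma cvg_Im f a : ctends F f a -> (fun x => Im (f x)) @ F --> Im a.
Proof.
move=> fa; have ImE (z : R[i]) : Im z = - Re (z * 'i) by rewrite ReiNIm opprK.
rewrite ImE (_ : (fun x => Im (f x)) = (fun x => - Re (f x * 'i))).
  apply: (@cvgN _ R^o); apply: cvg_Re.
  by apply: (@ctendsM R[i]); [exact: fa|exact: ctends_cst].
by apply/funext => x; rewrite ImE.
Qed.

End ComplexLimits.

(** * The unit circle: paths and rounding of phases *)
Section Circle.
Variable R : realType.
Implicit Types (z v : R[i]) (s t a : R) (q n : nat).

Definition expi t : R[i] := cos t +i* sin t.

Lemma expi0 : expi 0 = 1.
Proof. by rewrite /expi cos0 sin0. Qed.

Lemma expiD s t : expi (s + t) = expi s * expi t.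
Proof.
rewrite /expi cosD sinD; apply/eqP; rewrite eq_complex /= eqxx /= addrC.
by rewrite [X in _ == _ + X]mulrC [cos s * sin t]mulrC; apply/eqP; ring.
Qed.

Lemma expiMn t n : expi (t *+ n) = expi t ^+ n.
Proof.
elim: n => [|n IHn]; first by rewrite mulr0n expi0 expr0.
by rewrite mulrS expiD IHn exprS.
Qed.

Lemma norm_expi t : `|expi t| = 1.
Proof. by rewrite normc_def /= cos2Dsin2 sqrtr1. Qed.

Lemma expi_neq0 t : expi t != 0.
Proof. by rewrite -normr_eq0 norm_expi oner_eq0. Qed.

Lemma expi_surj z : `|z| = 1 -> exists t, expi t = z.
Proof.
case: z => x y; rewrite normc_def /= => -[h].
have xy : x ^+ 2 + y ^+ 2 = 1.
  have h0 : 0 <= x ^+ 2 + y ^+ 2 by rewrite addr_ge0 ?sqr_ge0.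
  by rewrite -(sqr_sqrtr h0) h expr1n.
have x1 : -1 <= x <= 1.
  rewrite -ler_norml -(@expr_le1 _ 2) // real_normK ?num_real // -xy.
  by rewrite lerDl sqr_ge0.
have sE : sin (acos x) = `|y|.
  by rewrite sin_acos // -xy addrAC subrr add0r sqrtr_sqr.
have [y0|y0] := leP 0 y.
  by exists (acos x); rewrite /expi acosK ?in_itv //= sE ger0_norm.
by exists (- acos x); rewrite /expi cosN sinN acosK ?in_itv //= sE ltr0_norm ?opprK.
Qed.

Lemma ctends_expi (T : Type) (F : set_system T) {FF : Filter F}
    (f : T -> R) (l : R) :
  f @ F --> l -> ctends F (fun x => expi (f x)) (expi l).
Proof.
move=> fl; rewrite /expi [X in ctends _ _ X]complexE /=.
apply: (@ctends_eq _ _ _ _ (fun x => (cos (f x))%:C + 'i * (sin (f x))%:C)).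
  by move=> x; rewrite [LHS]complexE.
apply: ctendsD; last apply: ctendsM; try exact: ctends_cst.
  by apply: ctends_real; apply: continuous_cvg; [exact: continuous_cos|exact: fl].
by apply: ctends_real; apply: continuous_cvg; [exact: continuous_sin|exact: fl].
Qed.

Lemma ex_root_circle z n : (0 < n)%N -> `|z| = 1 ->
  exists2 w : R[i], `|w| = 1 & w ^+ n = z.
Proof.
move=> n0 /expi_surj[t <-]; exists (expi (t / n%:R)); first exact: norm_expi.
by rewrite -expiMn -[t / _ *+ n]mulr_natr divfK // pnatr_eq0 -lt0n.
Qed.

(** Some argument of [z] if [z] has modulus 1; the choice need not be
    continuous, as it is only made on finite sets of roots of unity. *)
Definition angle z : R := xget 0 [set t | expi t = z].

Lemma expi_angle z : `|z| = 1 -> expi (angle z) = z.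
Proof. by move=> /expi_surj[t tz]; rewrite /angle; case: xgetP => // /(_ t). Qed.

(** A path on the circle that runs from [z], at [a = 0], to [z ^ q], at
    [a = 1]. *)
Definition power_arc q z a : R[i] := expi (angle z * (1 - a + a * q%:R)).

Lemma power_arc0 q z : `|z| = 1 -> power_arc q z 0 = z.
Proof. by move=> z1; rewrite /power_arc subr0 mul0r addr0 mulr1 expi_angle. Qed.

Lemma power_arc1 q z : `|z| = 1 -> power_arc q z 1 = z ^+ q.
Proof.
move=> z1; rewrite /power_arc subrr mul1r add0r mulr_natr expiMn.
by rewrite expi_angle.
Qed.

Lemma ctends_power_arc (T : Type) (F : set_system T) {FF : Filter F} q z
    (f : T -> R) (l : R) :
  f @ F --> l -> ctends F (fun x => power_arc q z (f x)) (power_arc q z l).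
Proof.
move=> fl; apply: ctends_expi; apply: cvgM; first exact: cvg_cst.
apply: cvgD; first by apply: cvgB => //; exact: cvg_cst.
by apply: cvgM => //; exact: cvg_cst.
Qed.

(** On the right half-plane the phase of [root_phase q v] is inverse to the
    principal [q]-th root of the phase of [v]; the factor [Re v] extends it
    continuously by 0.  Since it depends on [y] through [y ^ q] only,
    [y * root_phase q (y ^ q)] commutes with multiplication of [y] by [q]-th
    roots of unity; it rounds the phase of [y] to the nearest such root, or
    vanishes if [y] is far from all of them. *)
Definition root_phase q v : R[i] :=
  (Num.max 0 (Re v))%:C * expi (- atan (Im v / Re v) / q%:R).

Lemma ctends_root_phase (T : Type) (F : set_system T) {FF : Filter F} q
    (f : T -> R[i]) l :
  ctends F f l -> ctends F (fun x => root_phase q (f x)) (root_phase q l).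
Proof.
move=> fl.
have fR := @cvg_Re _ _ _ FF _ _ fl; have fI := @cvg_Im _ _ _ FF _ _ fl.
have fm : ctends F (fun x => (Num.max 0 (Re (f x)))%:C) (Num.max 0 (Re l))%:C.
  apply: ctends_real; have E (x : R) : Num.max 0 x = (`|x| + x) / 2.
    by have [x0|x0] := leP 0 x; [rewrite ger0_norm|rewrite ltr0_norm]; lra.
  rewrite E (_ : (fun x => _) = (fun x => (`|Re (f x)| + Re (f x)) / 2)).
    apply: cvgM; last exact: cvg_cst.
    by apply: cvgD => //; exact: cvg_norm.
  by apply/funext => x; rewrite E.
have [l0|l0] := eqVneq (Re l) 0.
  rewrite /root_phase l0 maxxx mul0r; apply: ctends_mul_bounded0.
    by rewrite l0 maxxx in fm.
  by move=> x; rewrite norm_expi.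
apply: ctendsM fm _; apply: ctends_expi; apply: cvgM; last exact: cvg_cst.
apply: cvgN; apply: continuous_cvg; first exact: continuous_atan.
by apply: cvgM => //; exact: cvgV.
Qed.

Lemma root_phase_ge0 q v : (0 < q)%N -> 0 <= v * root_phase q v ^+ q.
Proof.
move=> q0; rewrite /root_phase.
have [v0|v0] := leP (Re v) 0.
  by rewrite mul0r expr0n eqn0Ngt q0 mulr0.
rewrite exprMn -expiMn -[(_ / _) *+ q]mulr_natr divfK ?pnatr_eq0 -?lt0n //.
rewrite mulrCA mulr_ge0 //; first by rewrite exprn_ge0 // ler0c ltW.
set t := atan _.
have c0 : 0 < cos t by apply: cos_gt0_pihalf; rewrite atan_gtNpi2 atan_ltpi2.
have sE : sin t = cos t * (Im v / Re v).
  by rewrite -(atanK (Im v / Re v)) /tan mulrC divfK ?gt_eqF.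
clearbody t; case: v v0 sE => x y /= x0 sE.
rewrite lecE /= cosN sinN sE; apply/andP; split.
  by apply/eqP; field; rewrite gt_eqF.
have -> : x * cos t - y * - (cos t * (y / x)) = cos t / x * (x ^+ 2 + y ^+ 2).
  by field; rewrite gt_eqF.
by rewrite mulr_ge0 ?divr_ge0 ?addr_ge0 ?sqr_ge0 // ltW.
Qed.

Lemma root_phase_neq0 q v : 0 < v -> root_phase q v != 0.
Proof.
case: v => x y; rewrite ltcE /= => /andP[_ x0].
by rewrite mulf_neq0 ?expi_neq0 // max_r ?ltW // eq_complex /= negb_and gt_eqF.
Qed.

End Circle.

(** * The contraction: algebra *)
Section StepAlgebra.
Variable K : numFieldType.
Implicit Types (c w b g s u x y : K) (q n : nat).

Lemma norm1_neq0 (c : K) : `|c| = 1 -> c != 0.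
Proof. by move=> c1; rewrite -normr_eq0 c1 oner_eq0. Qed.

Lemma norm_root1 n (g : K) : (0 < n)%N -> g ^+ n = 1 -> `|g| = 1.
Proof.
by move=> n0 gn; apply/eqP; rewrite -(@pexpr_eq1 _ _ n) // -normrX gn normr1.
Qed.

Definition phase b : K := b / `|b|.

Lemma phase0 : phase 0 = 0.
Proof. exact: mul0r. Qed.

Lemma phase_neq0 b : b != 0 -> phase b != 0.
Proof. by move=> b0; rewrite mulf_neq0 // invr_neq0 // normr_eq0. Qed.

Lemma norm_phase b : b != 0 -> `|phase b| = 1.
Proof. by move=> b0; rewrite normrM normfV normr_id divff // normr_eq0. Qed.

Lemma norm_phase_le1 b : `|phase b| <= 1.
Proof.
by have [->|b0] := eqVneq b 0; [rewrite phase0 normr0|rewrite norm_phase].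
Qed.

Lemma norm_phase_div b g : `|g| = 1 -> b != 0 -> `|phase b / g| = 1.
Proof. by move=> g1 b0; rewrite normrM norm_phase // normfV g1 invr1 mulr1. Qed.

Lemma phase_root n b : 0 <= b ^+ n -> b != 0 -> phase b ^+ n = 1.
Proof.
move=> bn b0; rewrite expr_div_n -normrX ger0_norm // divff //.
by rewrite expf_neq0.
Qed.

Lemma phaseM c b : `|c| = 1 -> phase (c * b) = c * phase b.
Proof. by move=> c1; rewrite /phase normrM c1 mul1r mulrA. Qed.

Lemma phaseM_div c b g : `|c| = 1 -> phase (c * b) / (c * g) = phase b / g.
Proof.
move=> c1; rewrite phaseM // -mulf_div divff ?mul1r //.
exact: norm1_neq0.
Qed.

(** Here [w] and [b] are the coordinates of a point of [S^1 * mu_(q * q)],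
    [g] is the phase of a point of [G], [u] is the point reached on the arc that starts at
    [phase b / g], and [s] is the amount of shrinking towards the centre of the
    disc.  For [g = 1] and [s = 0] this is [w ^ q - u ^ q |b|]; multiplying the
    three arguments by a common phase [c] multiplies the value by [c ^ q]
    ([join_fstM]), which dictates where [g] occurs.  For positive [s] the disc
    coordinates [(w, |b|)] become [((1 - s) w, s + (1 - s) |b|)], which tend to
    those of the centre. *)
Definition join_fst q w b g s u : K :=
  ((1 - s) * w) ^+ q - g ^+ q * (s + (1 - s) * (`|b| * u ^+ q)).

Definition join_snd q w b g s u : K :=
  (1 - s) * w / g * (s * g ^+ q + (1 - s) * (`|b| * (phase b ^+ q / u))).

(** The homotopy stays, up to rounding, in the complex [S^1 * mu_q]: there are
    no common zeros and on the zeros of the first coordinate the second one lies on the rays through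
    [mu_q].  Indeed [join_fst = 0] expresses [((1 - s) w) ^ q] by [g], [u] and
    [|b|], and in [join_snd ^ q] all the phases cancel.  Shrinking is allowed only
    at the end of the arc, where the label [phase b] of the disc cancels. *)
Lemma join_snd_gt0 q w b g s u :
    (0 < q)%N -> 0 <= b ^+ (q * q) -> (w != 0) || (b != 0) ->
    g ^+ (q * q) = 1 -> u != 0 -> 0 <= s <= 1 ->
    (s != 0 -> b != 0 -> u = (phase b / g) ^+ q) ->
    join_fst q w b g s u = 0 ->
  0 < join_snd q w b g s u ^+ q.
Proof.
move=> q0 bQ wb gQ u0 s01 su /eqP; rewrite subr_eq0 => /eqP fst0.
have qq0 : (0 < q * q)%N by rewrite muln_gt0 q0.
have g0 : g != 0 := norm1_neq0 (norm_root1 qq0 gQ).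
have gqq : (g ^+ q) ^+ q = 1 by rewrite -exprM.
have zqq : b != 0 -> (phase b ^+ q) ^+ q = 1.
  by move=> b0; rewrite -exprM; exact: phase_root.
have [s0|s0] := eqVneq s 0.
  move: fst0; rewrite s0 /join_snd subr0 !mul1r mul0r !add0r => wq.
  have b0 : b != 0.
    apply: contraTneq wb => b0; rewrite b0 eqxx orbF negbK.
    by move: wq; rewrite b0 normr0 mul0r mulr0 => /eqP; rewrite expf_eq0 q0.
  (* No shrinking: the phases cancel because [phase b ^+ (q * q) = 1]. *)
  have -> : (w / g * (`|b| * (phase b ^+ q / u))) ^+ q = `|b| ^+ q.+1.
    move: (zqq b0) wq; move: (phase b) => z zq wq.
    rewrite !(exprMn, exprVn) zq wq exprS; field.
    by rewrite !expf_neq0.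
  by rewrite exprn_gt0 // normr_gt0.
have sgt0 : 0 < s by rewrite lt_neqAle eq_sym s0; case/andP: s01.
have {}su := su s0.
(* Some shrinking: [u] is at the end of its arc, where [u ^+ q = 1] and
   [phase b ^+ q / u = g ^+ q]; only the radial coordinate [r] is left. *)
pose r := s + (1 - s) * `|b|.
have r0 : 0 < r.
  by rewrite ltr_wpDr // mulr_ge0 // subr_ge0; case/andP: s01.
have xE : `|b| * u ^+ q = `|b|.
  have [->|b0] := eqVneq b 0; first by rewrite normr0 mul0r.
  by rewrite su // -exprM expr_div_n gQ phase_root // divr1 mulr1.
have yE : `|b| * (phase b ^+ q / u) = `|b| * g ^+ q.
  have [->|b0] := eqVneq b 0; first by rewrite normr0 !mul0r.
  have := phase_neq0 b0; rewrite su //; move: (phase b) => z z0.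
  by rewrite expr_div_n; field; rewrite !expf_neq0.
rewrite xE in fst0; rewrite /join_snd yE.
have -> : (1 - s) * w / g * (s * g ^+ q + (1 - s) * (`|b| * g ^+ q)) =
    (1 - s) * w / g * (g ^+ q * r) by rewrite /r; ring.
have -> : ((1 - s) * w / g * (g ^+ q * r)) ^+ q = r ^+ q.+1.
  rewrite exprMn expr_div_n fst0 exprMn gqq -/r exprS; field.
  by rewrite expf_neq0.
by rewrite exprn_gt0.
Qed.

(** At the start of the homotopy [g] has disappeared, as gluing at the end [X]
    of the join requires. *)
Lemma join_fst0 q w b g u : g != 0 -> (b != 0 -> u = phase b / g) ->
  join_fst q w b g 0 u = w ^+ q - `|b| * phase b ^+ q.
Proof.
move=> g0 uE; rewrite /join_fst subr0 !mul1r add0r; congr (_ - _).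
have [->|b0] := eqVneq b 0; first by rewrite normr0 !mul0r mulr0.
rewrite uE //; move: (phase b) => z.
by rewrite expr_div_n; field; rewrite expf_neq0.
Qed.

Lemma join_snd0 q w b g u : g != 0 -> (b != 0 -> u = phase b / g) ->
  join_snd q w b g 0 u = w * (`|b| * (phase b ^+ q / phase b)).
Proof.
move=> g0 uE; rewrite /join_snd subr0 !mul1r mul0r add0r.
have [->|b0] := eqVneq b 0; first by rewrite normr0 !(mul0r, mulr0).
have := phase_neq0 b0.
by rewrite uE //; move: (phase b) => z z0; field; rewrite z0.
Qed.

(** At the end of the homotopy only [g] is left, as gluing at the end [G] of the
    join requires. *)
Lemma join_fst1 q w b g u : (0 < q)%N -> join_fst q w b g 1 u = - g ^+ q.
Proof.
move=> q0; rewrite /join_fst subrr !mul0r addr0 mulr1.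
by rewrite expr0n eqn0Ngt q0 sub0r.
Qed.

Lemma join_snd1 q w b g u : join_snd q w b g 1 u = 0.
Proof. by rewrite /join_snd subrr !mul0r. Qed.

Lemma join_fstM q c w b g s u : `|c| = 1 ->
  join_fst q (c * w) (c * b) (c * g) s u = c ^+ q * join_fst q w b g s u.
Proof. by move=> c1; rewrite /join_fst normrM c1 mulrCA !exprMn; ring. Qed.

Lemma join_sndM q c w b g s u : `|c| = 1 ->
  join_snd q (c * w) (c * b) (c * g) s u = c ^+ q * join_snd q w b g s u.
Proof.
move=> c1; have c0 := norm1_neq0 c1.
rewrite /join_snd phaseM // normrM c1 !exprMn.
have -> : (1 - s) * (c * w) / (c * g) = (1 - s) * w / g.
  by rewrite mulrCA -mulf_div divff // mul1r.
by ring.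
Qed.

End StepAlgebra.

(** * The contraction: continuity *)
Section StepContinuity.
Variables (K : numFieldType) (T : topologicalType).

(** A bounded factor may be discontinuous where it is multiplied by 0.  The
    phase of [b] and the arcs starting from it have no limit at the zeros of
    [b], and they always come with the factor [|b|]. *)
Lemma ctends_norm_mul (b h : T -> K) (x : T) :
    ctends (nbhs x) b (b x) -> (forall y, `|h y| <= 1) ->
    (b x != 0 -> ctends (nbhs x) h (h x)) ->
  ctends (nbhs x) (fun y => `|b y| * h y) (`|b x| * h x).
Proof.
move=> cb h1 ch.
have [b0|b0] := eqVneq (b x) 0.
  rewrite b0 normr0 mul0r; apply: ctends_mul_bounded0 => //.
  by have := @ctends_norm _ _ _ (nbhs_filter x) _ _ cb; rewrite b0 normr0.
by apply: ctendsM; [exact: ctends_norm|exact: ch].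
Qed.

Lemma near_phase n (b : T -> K) x : (0 < n)%N -> (forall y, 0 <= b y ^+ n) ->
    ctends (nbhs x) b (b x) -> b x != 0 ->
  \forall y \near x, phase (b y) = phase (b x).
Proof.
move=> n0 bn cb b0; have nb0 : \forall y \near x, b y != 0.
  have bx : 0 < `|b x| by rewrite normr_gt0.
  have := @cvgr_norm_gt K K^o _ _ (nbhs_filter x) _ _ cb _ bx.
  by apply: filterS => y; rewrite normr_gt0.
apply: (@ctends_root_eq _ _ _ _ n) => //; first exact: phase_neq0.
  apply: ctendsM => //; apply: ctendsV; rewrite ?normr_eq0 //.
  exact: ctends_norm.
by apply: filterS nb0 => y by0; rewrite !phase_root.
Qed.

Variables (q : nat) (w b g s u : T -> K) (x : T).
Hypotheses (q0 : (0 < q)%N) (bQ : forall y, 0 <= b y ^+ (q * q)).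
Hypotheses (gx0 : g x != 0) (u1 : forall y, `|u y| = 1).
Hypotheses (cw : ctends (nbhs x) w (w x)) (cb : ctends (nbhs x) b (b x)).
Hypotheses (cg : ctends (nbhs x) g (g x)) (cs : ctends (nbhs x) s (s x)).
Hypothesis cu : b x != 0 -> ctends (nbhs x) u (u x).

Lemma join_fst_continuous :
  ctends (nbhs x) (fun y => join_fst q (w y) (b y) (g y) (s y) (u y))
    (join_fst q (w x) (b x) (g x) (s x) (u x)).
Proof.
have c1s : ctends (nbhs x) (fun y => 1 - s y) (1 - s x).
  by apply: ctendsB => //; exact: ctends_cst.
apply: ctendsB; first by apply: ctendsX; exact: ctendsM.
apply: ctendsM; first exact: ctendsX.
apply: ctendsD => //; apply: ctendsM => //.
apply: (ctends_norm_mul (h := fun y => u y ^+ q)) => // [y|b0].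
  by rewrite normrX u1 expr1n.
by apply: ctendsX; exact: cu.
Qed.

Lemma join_snd_continuous :
  ctends (nbhs x) (fun y => join_snd q (w y) (b y) (g y) (s y) (u y))
    (join_snd q (w x) (b x) (g x) (s x) (u x)).
Proof.
have c1s : ctends (nbhs x) (fun y => 1 - s y) (1 - s x).
  by apply: ctendsB => //; exact: ctends_cst.
apply: ctendsM; first by apply: ctendsM; [exact: ctendsM|exact: ctendsV].
apply: ctendsD; first by apply: ctendsM => //; exact: ctendsX.
apply: ctendsM => //.
apply: (ctends_norm_mul (h := fun y => phase (b y) ^+ q / u y)) => // [y|b0].
  rewrite normrM normfV u1 invr1 mulr1 normrX exprn_ile1 //.
  exact: norm_phase_le1.
apply: ctendsM; last by apply: ctendsV; [exact: norm1_neq0|exact: cu].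
apply: ctends_near_eq; last exact: ctends_cst.
have qq0 : (0 < q * q)%N by rewrite muln_gt0 q0.
by apply: filterS (near_phase qq0 bQ cb b0) => y ->.
Qed.

End StepContinuity.

(** * The contraction parametrized by the join *)
Section Step.
Variable R : realType.
Implicit Types (w b g : R[i]) (t : R) (q n : nat).

(** The first half of the unit interval is spent on turning along the arc and
    the second half on shrinking, so that shrinking starts at the end of the
    arc. *)
Definition shrink t : R := Num.max 0 (2 * t - 1).
Definition turn t : R := Num.min 1 (2 * t).

Lemma shrinkE t : shrink t = (`|2 * t - 1| + (2 * t - 1)) / 2.
Proof.
rewrite /shrink; have [h|h] := leP 0 (2 * t - 1).
  by rewrite ger0_norm //; lra.
by rewrite ltr0_norm //; lra.
Qed.

Lemma turnE t : turn t = (1 + 2 * t - `|2 * t - 1|) / 2.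
Proof.
rewrite /turn; have [h|h] := leP 1 (2 * t).
  by rewrite ger0_norm; lra.
by rewrite ltr0_norm; lra.
Qed.

Lemma shrink0 : shrink 0 = 0.
Proof. by rewrite /shrink; apply/max_idPl; lra. Qed.

Lemma turn0 : turn 0 = 0.
Proof. by rewrite /turn mulr0; apply/min_idPr; lra. Qed.

Lemma shrink1 : shrink 1 = 1.
Proof.
by rewrite /shrink; apply/eqP; rewrite eq_le ge_max le_max; lra.
Qed.

Lemma shrink01 t : 0 <= t <= 1 -> 0 <= (shrink t)%:C <= 1.
Proof.
by move=> t01; rewrite ler0c (lecR _ 1) /shrink le_max lexx /= ge_max; lra.
Qed.

Lemma turn_shrink t : shrink t != 0 -> turn t = 1.
Proof.
rewrite /shrink /turn; case: leP => h; rewrite ?eqxx // => _.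
by apply/min_idPl; lra.
Qed.

Definition step_fst q w b g t : R[i] :=
  join_fst q w b g (shrink t)%:C (power_arc q (phase b / g) (turn t)).

Definition step_snd q w b g t : R[i] :=
  join_snd q w b g (shrink t)%:C (power_arc q (phase b / g) (turn t)).

Lemma step_snd_gt0 q w b g t :
    (0 < q)%N -> 0 <= b ^+ (q * q) -> (w != 0) || (b != 0) ->
    g ^+ (q * q) = 1 -> 0 <= t <= 1 ->
    step_fst q w b g t = 0 -> 0 < step_snd q w b g t ^+ q.
Proof.
move=> q0 bQ wb gQ t01.
have g1 : `|g| = 1 by apply: norm_root1 gQ; rewrite muln_gt0 q0.
apply: join_snd_gt0 => //; [exact: expi_neq0|exact: shrink01|].
move=> s0 b0; rewrite turn_shrink; first by rewrite power_arc1 // norm_phase_div.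
by apply: contraNneq s0 => ->.
Qed.

Lemma step_fstM q (c : R[i]) w b g t : `|c| = 1 ->
  step_fst q (c * w) (c * b) (c * g) t = c ^+ q * step_fst q w b g t.
Proof. by move=> c1; rewrite /step_fst phaseM_div // join_fstM. Qed.

Lemma step_sndM q (c : R[i]) w b g t : `|c| = 1 ->
  step_snd q (c * w) (c * b) (c * g) t = c ^+ q * step_snd q w b g t.
Proof. by move=> c1; rewrite /step_snd phaseM_div // join_sndM. Qed.

Lemma step_fst0 q w b g : `|g| = 1 ->
  step_fst q w b g 0 = w ^+ q - `|b| * phase b ^+ q.
Proof.
move=> g1; rewrite /step_fst shrink0 turn0; apply: join_fst0.
  exact: norm1_neq0.
by move=> b0; rewrite power_arc0 // norm_phase_div.
Qed.

Lemma step_snd0 q w b g : `|g| = 1 ->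
  step_snd q w b g 0 = w * (`|b| * (phase b ^+ q / phase b)).
Proof.
move=> g1; rewrite /step_snd shrink0 turn0; apply: join_snd0.
  exact: norm1_neq0.
by move=> b0; rewrite power_arc0 // norm_phase_div.
Qed.

Lemma step_fst1 q w b g : (0 < q)%N -> step_fst q w b g 1 = - g ^+ q.
Proof. by move=> q0; rewrite /step_fst shrink1; apply: join_fst1. Qed.

Lemma step_snd1 q w b g : step_snd q w b g 1 = 0.
Proof. by rewrite /step_snd shrink1; apply: join_snd1. Qed.

Section Continuity.
Variables (T : topologicalType) (q : nat) (w b g : T -> R[i]) (t : T -> R).
Variable x : T.
Hypotheses (q0 : (0 < q)%N) (bQ : forall y, 0 <= b y ^+ (q * q)).
Hypothesis gQ : forall y, g y ^+ (q * q) = 1.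
Hypotheses (cw : ctends (nbhs x) w (w x)) (cb : ctends (nbhs x) b (b x)).
Hypotheses (cg : ctends (nbhs x) g (g x)) (ct : t @ x --> t x).

Let qq0 : (0 < q * q)%N. Proof. by rewrite muln_gt0 q0. Qed.
Let gx0 : g x != 0. Proof. exact: norm1_neq0 (norm_root1 qq0 (gQ x)). Qed.

Let cs : ctends (nbhs x) (fun y => (shrink (t y))%:C) (shrink (t x))%:C.
Proof.
apply: ctends_real; rewrite shrinkE (_ : (fun y => _) =
  (fun y => (`|2 * t y - 1| + (2 * t y - 1)) / 2)); last first.
  by apply/funext => y; rewrite shrinkE.
have c2 : (fun y => 2 * t y - 1) @ x --> 2 * t x - 1.
  by apply: cvgB; [apply: cvgM => //; exact: cvg_cst|exact: cvg_cst].
apply: cvgM; last exact: cvg_cst.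
by apply: cvgD => //; exact: cvg_norm.
Qed.

Let cturn : (fun y => turn (t y)) @ x --> turn (t x).
Proof.
rewrite turnE (_ : (fun y => _) =
  (fun y => (1 + 2 * t y - `|2 * t y - 1|) / 2)); last first.
  by apply/funext => y; rewrite turnE.
have c2 : (fun y => 2 * t y) @ x --> 2 * t x by apply: cvgM => //; exact: cvg_cst.
apply: cvgM; last exact: cvg_cst.
apply: cvgB; first by apply: cvgD => //; exact: cvg_cst.
by apply: cvg_norm; apply: cvgB => //; exact: cvg_cst.
Qed.

Let cu : b x != 0 ->
  ctends (nbhs x) (fun y => power_arc q (phase (b y) / g y) (turn (t y)))
    (power_arc q (phase (b x) / g x) (turn (t x))).
Proof.
move=> b0.
have ng : \forall y \near x, g y = g x.
  apply: (@ctends_root_eq R[i] _ _ _ (q * q)); [exact: qq0|exact: gx0|exact: cg|].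
  by apply: nearW => y; rewrite !gQ.
have nb := @near_phase R[i] T (q * q) b x qq0 bQ cb b0.
apply: (@ctends_near_eq R[i] _ _ _ _
  (fun y => power_arc q (phase (b x) / g x) (turn (t y)))).
  by apply: filterS2 ng nb => y -> ->.
exact: ctends_power_arc.
Qed.

Lemma step_fst_continuous :
  ctends (nbhs x) (fun y => step_fst q (w y) (b y) (g y) (t y))
    (step_fst q (w x) (b x) (g x) (t x)).
Proof.
apply: (@join_fst_continuous R[i] T q w b g (fun y => (shrink (t y))%:C)
  (fun y => power_arc q (phase (b y) / g y) (turn (t y))) x).
- by move=> y; exact: norm_expi.
- exact: cw.
- exact: cb.
- exact: cg.
- exact: cs.
- exact: cu.
Qed.

Lemma step_snd_continuous :
  ctends (nbhs x) (fun y => step_snd q (w y) (b y) (g y) (t y))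
    (step_snd q (w x) (b x) (g x) (t x)).
Proof.
apply: (@join_snd_continuous R[i] T q w b g (fun y => (shrink (t y))%:C)
  (fun y => power_arc q (phase (b y) / g y) (turn (t y))) x).
- exact: q0.
- exact: bQ.
- exact: gx0.
- by move=> y; exact: norm_expi.
- exact: cw.
- exact: cb.
- exact: cg.
- exact: cs.
- exact: cu.
Qed.

End Continuity.

End Step.

(** * Polar pairs on joins *)
Section Descent.
Variables (R : realType) (X Y : topologicalType).

Lemma join_descend (f : prejoin R X Y -> R[i]) :
    (forall a, ctends (nbhs a) f (f a)) ->
    (forall a b, join_rel a b -> f a = f b) ->
  exists2 F : join R X Y -> R[i],
    forall z, ctends (nbhs z) F (F z) & forall a, F (join_pi a) = f a.
Proof.
move=> cf rf.
pose F (z : join R X Y) : R[i] := f (projT1 (cid (join_pi_surj z))).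
have FE a : F (join_pi a) = f a.
  by rewrite /F; case: cid => d /= /join_piP/rf.
exists F => //.
have : continuous ((F : join R X Y -> R[i]^o) \o @join_pi R X Y).
  by rewrite (_ : _ \o _ = (f : _ -> R[i]^o)); [exact: cf|exact/funext].
by move=> /join_continuousP cF z; exact: cF.
Qed.

End Descent.

Section PolarPair.
Variables (R : realType) (G : compactGroup).

(** A [chi]-equivariant map from [X] to [S^1 * mu_n]: a nonnegative [n]-th power
    means a phase in [mu_n]. *)
Record polar_pair (X : gspace G) (chi : G -> R[i]) (n : nat) (w b : X -> R[i])
    : Prop := PolarPair {
  pair_fst_continuous : forall x, ctends (nbhs x) w (w x);
  pair_snd_continuous : forall x, ctends (nbhs x) b (b x);
  pair_fst_act : forall x h, w (gact x h) = chi h * w x;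
  pair_snd_act : forall x h, b (gact x h) = chi h * b x;
  pair_neq0 : forall x, (w x != 0) || (b x != 0);
  pair_snd_ge0 : forall x, 0 <= b x ^+ n }.

Variables (X : gspace G) (chi : G -> R[i]) (q : nat) (w b : X -> R[i]).
Hypotheses (q0 : (0 < q)%N) (chiQ : forall g, chi g ^+ (q * q) = 1).
Hypothesis chiD : forall g h, chi (g + h) = chi h * chi g.
Hypothesis chi_continuous : forall g, ctends (nbhs g) chi (chi g).
Hypothesis wb : polar_pair chi (q * q) w b.

Local Notation P := (prejoin R X G).

Let chi1 g : `|chi g| = 1.
Proof. by apply: (@norm_root1 R[i] (q * q)); [rewrite muln_gt0 q0|]. Qed.

Let first (a : P) := step_fst q (w a.1.1) (b a.1.1) (chi a.1.2) (\val a.2).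
Let second (a : P) := step_snd q (w a.1.1) (b a.1.1) (chi a.1.2) (\val a.2).
Let rounded (a : P) := second a * root_phase q (second a ^+ q).

Let cx (a : P) : (fun a : P => a.1.1) @ a --> a.1.1.
Proof. by apply: (@continuous_comp _ _ _ fst); exact: cvg_fst. Qed.
Let cy (a : P) : (fun a : P => a.1.2) @ a --> a.1.2.
Proof. by apply: (@continuous_comp _ _ _ fst); [exact: cvg_fst|exact: cvg_snd]. Qed.
Let ct (a : P) : (fun a : P => \val a.2 : R) @ a --> (\val a.2 : R).
Proof.
apply: (@continuous_comp _ _ _ snd); first exact: cvg_snd.
exact: initial_continuous.
Qed.

Let cw (a : P) : ctends (nbhs a) (fun a : P => w a.1.1) (w a.1.1).
Proof. exact: cvg_comp (@cx a) (pair_fst_continuous wb (x := a.1.1)). Qed.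
Let cb (a : P) : ctends (nbhs a) (fun a : P => b a.1.1) (b a.1.1).
Proof. exact: cvg_comp (@cx a) (pair_snd_continuous wb (x := a.1.1)). Qed.
Let cchi (a : P) : ctends (nbhs a) (fun a : P => chi a.1.2) (chi a.1.2).
Proof. exact: cvg_comp (@cy a) (chi_continuous (g := a.1.2)). Qed.

Let first_continuous (a : P) : ctends (nbhs a) first (first a).
Proof.
apply: step_fst_continuous;
  [exact: q0| |by move=> y; exact: chiQ|exact: cw|exact: cb|exact: cchi|exact: ct].
by move=> y; exact: (pair_snd_ge0 wb).
Qed.

Let second_continuous (a : P) : ctends (nbhs a) second (second a).
Proof.
apply: step_snd_continuous;
  [exact: q0| |by move=> y; exact: chiQ|exact: cw|exact: cb|exact: cchi|exact: ct].
by move=> y; exact: (pair_snd_ge0 wb).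
Qed.

Let rounded_continuous (a : P) : ctends (nbhs a) rounded (rounded a).
Proof.
apply: (@ctendsM R[i]); first exact: second_continuous.
apply: ctends_root_phase; apply: (@ctendsX R[i]); exact: second_continuous.
Qed.

Let first_rel a a' : join_rel a a' -> first a = first a'.
Proof.
rewrite /first; case=> [->//|[-> -> ->]|[-> -> ->]].
  by rewrite !step_fst0.
by rewrite !step_fst1.
Qed.

Let second_rel a a' : join_rel a a' -> second a = second a'.
Proof.
rewrite /second; case=> [->//|[-> -> ->]|[-> -> _]].
  by rewrite !step_snd0.
by rewrite !step_snd1.
Qed.

Let first_act a h : first (prejoin_act a h) = chi h ^+ q * first a.
Proof.
rewrite /first /= (pair_fst_act wb) (pair_snd_act wb) chiD.
exact: step_fstM.
Qed.

Let second_act a h : second (prejoin_act a h) = chi h ^+ q * second a.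
Proof.
rewrite /second /= (pair_fst_act wb) (pair_snd_act wb) chiD.
exact: step_sndM.
Qed.

Let rounded_act a h : rounded (prejoin_act a h) = chi h ^+ q * rounded a.
Proof.
rewrite /rounded second_act [(_ * second a) ^+ q]exprMn -exprM chiQ mul1r.
exact/esym/mulrA.
Qed.

(** The coordinates of the contraction are compatible with the gluing of the
    join at both ends.  The second one is rounded, which does not change where
    it vanishes on the zero set of the first one. *)
Lemma join_polar_pair :
  exists w' b' : join_gspace R X -> R[i],
    polar_pair (fun g => chi g ^+ q) q w' b'.
Proof.
have [w' cw' w'E] := join_descend first_continuous first_rel.
have [b' cb' b'E] : exists2 F : join R X G -> R[i],
    forall z, ctends (nbhs z) F (F z) & forall a, F (join_pi a) = rounded a.
  apply: join_descend; first exact: rounded_continuous.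
  by move=> a a' /second_rel; rewrite /rounded => ->.
exists w', b'; split.
- exact: cw'.
- exact: cb'.
- by move=> z h; have [a <-] := join_pi_surj z; rewrite /= join_actE !w'E.
- by move=> z h; have [a <-] := join_pi_surj z; rewrite /= join_actE !b'E.
- move=> z; have [a <-] := join_pi_surj z; rewrite w'E b'E.
  have [a0|//] := eqVneq (first a) 0.
  have h : 0 < second a ^+ q.
    apply: (step_snd_gt0 q0 (pair_snd_ge0 wb _) (pair_neq0 wb _) (chiQ _) _ a0).
    by have := set_valP a.2; rewrite /= in_itv.
  rewrite mulf_neq0 ?root_phase_neq0 //.
  by apply: contraTneq h => ->; rewrite expr0n eqn0Ngt q0 ltxx.
- move=> z; have [a <-] := join_pi_surj z; rewrite b'E /rounded exprMn.
  exact: root_phase_ge0.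
Qed.

End PolarPair.

Section SpectralCount.
Variables (R : realType) (G : compactGroup) (X : gspace G).
Variable tau : character R G.

(** The two functions of the pair are their own partners: the sum to invert is
    [|w|^2 + |b|^2]. *)
Lemma spectral_witness1 n (w b : X -> R[i]) : polar_pair tau n w b ->
  spectral_witness (dual_action (R := R) (X := X)) tau 1.
Proof.
move=> wb.
have cw : continuous (w : X -> R[i]^o) by exact: (pair_fst_continuous wb).
have cb : continuous (b : X -> R[i]^o) by exact: (pair_snd_continuous wb).
pose f (i : 'I_2) : cfun R X := if i == ord0 then mkcfun cw else mkcfun cb.
have fS i : spectral_subspace (dual_action (R := R) (X := X)) tau (f i).
  rewrite /f; case: ifP => _ g; apply: cfunP => x /=.
    exact: (pair_fst_act wb).
  exact: (pair_snd_act wb).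
pose N x : R[i] := w x * (w x)^* + b x * (b x)^*.
have N0 x : N x != 0.
  rewrite /N -!normCK paddr_eq0 ?exprn_ge0 // !expf_eq0 /= !normr_eq0.
  by rewrite negb_and; exact: (pair_neq0 wb).
pose S : cfun R X := \sum_(i < 2) f i * star (f i).
have SE x : S x = N x by rewrite /S !big_ord_recl big_ord0 addr0.
have cV : continuous (fun x => (S x)^-1 : R[i]^o).
  move=> x; apply: (@ctendsV R[i]); first by rewrite SE.
  exact: cfun_continuous.
exists f, f; split => //.
exists (mkcfun cV); split; apply: cfunP => x.
  by apply: mulfV; rewrite SE.
by apply: mulVf; rewrite SE.
Qed.

End SpectralCount.

(** * Characters of the p-adic integers *)
Section NoSmallSubgroup.
Variable R : realType.

(** The half-plane [Re >= 0] contains no nontrivial subgroup of the circle: since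
    [Re (y ^ 2) = 2 (Re y) ^ 2 - 1], squaring at least doubles [1 - Re y] as long
    as [Re y >= 0], whereas [1 - Re y] stays bounded by 1. *)
Lemma no_small_subgroup (z : R[i]) : `|z| = 1 ->
  (forall k, 0 <= Re (z ^+ (2 ^ k))) -> z = 1.
Proof.
move=> z1 zk; pose u k := 1 - Re (z ^+ (2 ^ k)).
have nrm (y : R[i]) : `|y| = 1 -> Re y ^+ 2 + Im y ^+ 2 = 1.
  by move=> y1; apply: (@complexI R); rewrite add_Re2_Im2 y1 expr1n.
have u0 k : 0 <= u k.
  have /nrm h : `|z ^+ (2 ^ k)| = 1 by rewrite normrX z1 expr1n.
  by rewrite /u; nra.
have uS k : 2 * u k <= u k.+1.
  have /nrm h : `|z ^+ (2 ^ k)| = 1 by rewrite normrX z1 expr1n.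
  have sq (y : R[i]) : Re (y ^+ 2) = Re y ^+ 2 - Im y ^+ 2.
    by rewrite !expr2; case: y.
  rewrite /u expnS mulnC exprM sq; have := zk k; have := u0 k; rewrite /u.
  by nra.
have u2 k : 2 ^+ k * u 0%N <= 1.
  apply: (@le_trans _ _ (u k)); last by rewrite /u lerBlDr lerDl.
  elim: k => [|k IHk]; first by rewrite expr0 mul1r.
  by rewrite exprS -mulrA; apply: le_trans (uS k); rewrite ler_pM2l.
have uz : u 0%N = 0.
  apply/eqP; rewrite eq_le u0 andbT leNgt; apply/negP => upos.
  have [k kP] : exists k : nat, (u 0%N)^-1 < k%:R.
    by exists (Num.bound (u 0%N)^-1); apply: archi_boundP; rewrite invr_ge0 ltW.
  have : k%:R * u 0%N <= 1.
    apply: le_trans (u2 k); rewrite ler_pM2r // -natrX ler_nat.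
    by rewrite ltnW // ltn_expl.
  by rewrite -ler_pdivlMr // mul1r leNgt kP.
have := nrm z z1; move: uz; rewrite /u expn0 expr1.
case: z {z1 zk u u0 uS u2 nrm} => x y /= hx hn.
have -> : x = 1 by lra.
have -> : y = 0 by nra.
by [].
Qed.

End NoSmallSubgroup.

Section Padic.
Variable p : nat.
Hypothesis p_gt0 : (0 < p)%N.

Lemma residue0 n : residue (0 : padic_int p) n = 0.
Proof. exact: mod0z. Qed.

Lemma residue_le (g : padic_int p) m n : (m <= n)%N ->
  residue g n = 0 -> residue g m = 0.
Proof.
move=> /subnK <-; elim: (n - m)%N => [//|k IHk] gk; apply: IHk.
by rewrite residueE -addSn gk mod0z.
Qed.

(** The subgroups [p ^ N Z_p] form a neighbourhood basis of 0: otherwise a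
    neighbourhood avoids some [g N] with zero residue modulo [p ^ N] for every
    [N], but the sequence [g] converges to 0 residue by residue. *)
Lemma padic_nbhs0 (U : set (padic_int p)) : nbhs (0 : padic_int p) U ->
  exists N, forall g : padic_int p, residue g N = 0 -> U g.
Proof.
move=> U0; apply: contrapT => /forallNP h.
have /choice [g gP] : forall N, exists g : padic_int p, residue g N = 0 /\ ~ U g.
  by move=> N; have /existsNP[g /not_implyP gP] := h N; exists g.
have gN N n : (n <= N)%N -> residue (g N) n = 0.
  by move=> nN; exact: residue_le nN (gP N).1.
case: U0 => D [[E oE <-] /= E0 EU].
pose s N : {ptws nat -> discrete_topology int} := set_val (g N).
have sE : s @ \oo -->
    (set_val (0 : padic_int p) : {ptws nat -> discrete_topology int}).
  apply/(@pointwise_cvgP nat (discrete_topology int)) => n.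
  apply/discrete_cvg; exists n => // N /= nN.
  by rewrite -[LHS]/(residue (g N) n) -[RHS]/(residue 0 n) gN // residue0.
have nE :
    nbhs (set_val (0 : padic_int p) : {ptws nat -> discrete_topology int}) E.
  by apply: open_nbhs_nbhs; split.
have [N _ /(_ N (leqnn N)) NE] := sE _ nE.
by case: (gP N) => _; apply; exact: EU.
Qed.

Lemma residue_muln (g : padic_int p) k n :
  residue g n = 0 -> residue (g *+ k) n = 0.
Proof.
move=> g0; elim: k => [|k IHk]; first by rewrite mulr0n residue0.
by rewrite mulrS residueD g0 IHk addr0 mod0z.
Qed.

Definition padic_one : padic_int p := @mkpadic p (fun=> 1) (fun=> erefl).

(** Residues as natural numbers, for use as exponents. *)
Definition residuen (g : padic_int p) n : nat := `|residue g n|%N.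

Lemma PoszX n : p%:Z ^+ n = (p ^ n)%N%:Z.
Proof. by rewrite -[p%:Z]natz -natrX natz. Qed.

Lemma residuenE (g : padic_int p) n : residue g n = (residuen g n)%:Z.
Proof.
rewrite /residuen gez0_abs // -residue_mod modz_ge0 // PoszX.
by rewrite eqz_nat -lt0n expn_gt0 p_gt0.
Qed.

Lemma residuen_mod (g : padic_int p) n : (residuen g n %% p ^ n)%N = residuen g n.
Proof.
by apply/eqP; rewrite -eqz_nat -modz_nat -PoszX -residuenE residue_mod.
Qed.

Lemma residuenD (g h : padic_int p) n :
  residuen (g + h) n = ((residuen g n + residuen h n) %% p ^ n)%N.
Proof.
apply/eqP; rewrite -eqz_nat -residuenE residueD !residuenE PoszX.
by rewrite -PoszD modz_nat.
Qed.

Lemma residuen0 n : residuen 0 n = 0%N.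
Proof. by rewrite /residuen residue0. Qed.

Lemma residuen_one k n : residuen (padic_one *+ k) n = (k %% p ^ n)%N.
Proof.
elim: k => [|k IHk]; first by rewrite mulr0n residuen0 mod0n.
rewrite mulrS residuenD IHk modnDmr.
have -> : residuen padic_one n = (1 %% p ^ n)%N.
  apply/eqP; rewrite -eqz_nat -residuenE residue_mkpadic PoszX.
  by rewrite modz_nat.
by rewrite modnDml.
Qed.

Lemma residuen_le (g : padic_int p) m n : (m <= n)%N ->
  residuen g m = (residuen g n %% p ^ m)%N.
Proof.
move=> /subnK <-; elim: (n - m)%N => [|k ->]; first by rewrite residuen_mod.
have -> : residuen g (k + m) = (residuen g (k.+1 + m) %% p ^ (k + m))%N.
  apply/eqP; rewrite -eqz_nat -residuenE residueE residuenE PoszX.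
  by rewrite modz_nat.
by rewrite modn_dvdm // dvdn_exp2l // leq_addl.
Qed.

Lemma residuen_sub_one (g : padic_int p) n :
  residue (g - padic_one *+ residuen g n) n = 0.
Proof.
rewrite residueD residueN [residue (_ *+ _) n]residuenE residuen_one.
by rewrite residuen_mod modzDmr residuenE subrr mod0z.
Qed.

End Padic.

Section Characters.
Variables (R : realType) (p : nat) (p_prime : prime p).
Local Notation G := (padic_group p_prime).
Let p_gt0 := prime_gt0 p_prime.
Implicit Types (tau : character R G) (g h : padic_int p).

Lemma character0 tau : tau (0 : padic_int p) = 1.
Proof.
have t0 : tau (0 : padic_int p) != 0.
  exact: (@norm1_neq0 R[i] _ (character_norm tau _)).
apply: (mulfI t0); rewrite mulr1 -characterD; congr (tau _); exact: addr0.
Qed.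

Lemma characterMn tau g k : tau (g *+ k : padic_int p) = tau g ^+ k.
Proof.
elim: k => [|k IHk]; first by rewrite mulr0n expr0 character0.
by rewrite mulrS exprS -IHk; exact: characterD.
Qed.

(** By continuity a character maps some [p ^ N Z_p] into the right half-plane,
    so it is trivial there; modulo [p ^ N] every [g] is the multiple of 1 by its
    residue. *)
Lemma character_factor tau : exists N, tau (padic_one p) ^+ (p ^ N) = 1 /\
  forall g, tau g = tau (padic_one p) ^+ residuen g N.
Proof.
have ct : ctends (nbhs (0 : padic_int p)) tau (tau (0 : padic_int p)).
  exact (@character_continuous _ _ tau (0 : G)).
have cR := @cvg_Re _ _ _ (nbhs_filter _) _ _ ct.
have R0 : 0 < Re (tau (0 : padic_int p)) by rewrite character0 ltr01.
have /padic_nbhs0[N NP] := @cvgr_gt _ _ _ (nbhs_filter _) _ _ cR _ R0.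
have trivial g : residue g N = 0 -> tau g = 1.
  move=> g0; apply: no_small_subgroup => [|k]; first exact: character_norm.
  by rewrite -characterMn ltW //; apply: NP; exact: residue_muln.
exists N; split.
  rewrite -characterMn; apply: trivial.
  by rewrite (residuenE p_gt0) (residuen_one p_gt0) modnn.
move=> g; rewrite -characterMn.
have -> : tau g = tau (g - padic_one p *+ residuen g N : padic_int p) *
    tau (padic_one p *+ residuen g N : padic_int p).
  rewrite -characterD; congr (tau _); exact/esym/subrK.
by rewrite trivial ?mul1r //; exact: residuen_sub_one.
Qed.

Lemma character_torsion tau : exists k, forall g, tau g ^+ (p ^ k) = 1.
Proof.
have [N [t1 tE]] := character_factor tau; exists N => g.
by rewrite tE exprAC t1 expr1n.
Qed.

(** A [p ^ k]-th root [eta] of the value at 1, which is a [p ^ N]-th root of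
    unity, is a [p ^ (N + k)]-th root of unity, so it determines a character of
    the integers modulo [p ^ (N + k)]. *)
Lemma character_root tau k :
  exists chi : character R G, forall g, chi g ^+ (p ^ k) = tau g.
Proof.
have [N [t1 tE]] := character_factor tau.
have pk0 n : (0 < p ^ n)%N by rewrite expn_gt0 p_gt0.
have [eta eta1 etaE] := ex_root_circle (pk0 k) (character_norm tau (padic_one p)).
pose M := (N + k)%N.
have etaM : eta ^+ (p ^ M) = 1 by rewrite /M addnC expnD exprM etaE t1.
pose f (g : G) : R[i]^o := eta ^+ residuen g M.
have cf : continuous f.
  move=> g.
  have fg : \forall h \near g, f h = f g.
    have : nbhs (g : padic_int p) [set h | residue h M = residue g M].
      exact: (@residue_continuous p M g [set residue g M] (discrete_set1 _)).
    by apply: (@filterS _ _ (nbhs_filter g)) => h /= hg; rewrite /f /residuen hg.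
  have ng := nbhs_filter g.
  exact: (@ctends_near_eq R[i] _ _ ng _ _ _ fg (@ctends_cst R[i] _ _ ng _)).
have f1 g : `|f g| = 1 by rewrite normrX eta1 expr1n.
have fD g h : f (g + h) = f g * f h.
  by rewrite /f (residuenD p_gt0) (expr_mod _ etaM) exprD.
exists (Character cf f1 fD) => g /=.
rewrite /f exprAC etaE [RHS]tE (residuen_le p_gt0 g (leq_addr k N)).
by rewrite (expr_mod _ t1).
Qed.

(** The step from [X] to [X * G] lowers the order from [q * q] to [q] and
    replaces a character by its [q]-th power, so the induction hypothesis is used
    for a [p ^ k]-th root of [tau] and the order [p ^ (k + k)]. *)
Lemma join_power_polar_pair i tau k : (forall g, tau g ^+ (p ^ k) = 1) ->
  exists w b : iter i (fun X => join_gspace R X) (regular_gspace G) -> R[i],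
    polar_pair tau (p ^ k) w b.
Proof.
elim: i => [|i IHi] in tau k *.
  move=> tk; exists (fun=> 0), tau; split => /=.
  - by move=> x; exact: (@ctends_cst R[i]).
  - exact (@character_continuous _ _ tau).
  - by move=> x h; rewrite mulr0.
  - by move=> x h; rewrite mulrC; exact: characterD.
  - move=> x; apply/orP; right.
    exact: (@norm1_neq0 R[i] _ (character_norm tau _)).
  - by move=> x; rewrite tk.
move=> tk; have [chi chiE] := character_root tau k.
pose c (g : G) : R[i] := chi g.
have chi1 (g : G) : c g ^+ (p ^ k * p ^ k) = 1.
  by rewrite exprM [c g ^+ _]chiE; exact: tk.
have [w [b wb]] := IHi chi (k + k)%N
  (fun g => etrans (congr1 _ (expnD p k k)) (chi1 g)).
rewrite expnD in wb.
have pk0 : (0 < p ^ k)%N by rewrite expn_gt0 p_gt0.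
have chiD (g h : G) : c (g + h) = c h * c g by rewrite mulrC; exact: characterD.
have [w' [b' wb']] := @join_polar_pair R G _ c _ w b pk0 chi1 chiD
  (@character_continuous _ _ chi) wb.
exists w', b'; rewrite (_ : (tau : G -> R[i]) = (fun g => c g ^+ (p ^ k))) //.
by apply/funext => g; exact/esym/chiE.
Qed.

End Characters.

Theorem corollary3p17 (R : realType) (p : nat) (p_prime : prime p)
    (m : nat) (m_ge1 : (1 <= m)%N) (tau : character R (padic_group p_prime)) :
  (spectral_count
     (dual_action (R := R) (X := join_power R (padic_group p_prime) m)) tau
   <= 1)%E.
Proof.
have [k tk] := character_torsion tau.
have [w [b wb]] := join_power_polar_pair m.-1 tk.
apply: ereal_inf_lbound; exists 1%N => //.
exact: spectral_witness1 wb.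
Qed.
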